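(* Let $K$ be a field of characteristic $0$. Fix integers $k\ge0$, $a\ge1$, $g\ge0$ and lengths $\ell_r,\ell_l\ge1$, and let $H$ be the set of pairs $(\mathbf{w}^{(r)},\mathbf{w}^{(l)})\in\mathbb{N}^{\ell_r+\ell_l}$ with all entries odd such that $\sum_j\mathbf{w}^{(r)}_j=b$ and $\sum_i\mathbf{w}^{(l)}_i=ak+b$ for some $b$. The function $$N^{\mathrm{floor}}_{\mathbb{A}^1}(k,a,g):H\to\mathrm{GW}(K),\qquad(\mathbf{w}^{(r)},\mathbf{w}^{(l)})\mapsto N^{\mathrm{floor}}_{\mathbb{A}^1}\big(\Delta_k(\mathbf{w}^{(r)},\mathbf{w}^{(l)},a),g\big)$$ associates to a tuple $(\mathbf{w}^{(r)},\mathbf{w}^{(l)})$ of odd weights an element of $\mathrm{GW}(K)$ which equals a multiple of $\mathbb{H}$ plus a (finite, possibly empty) sum of quadratic forms of the form $\big\langle(-1)^i\cdot\prod_s\mathbf{w}^{(r)}_s\prod_t\mathbf{w}^{(l)}_t\big\rangle$ with $i\in\mathbb{Z}$. The coefficient of $\mathbb{H}$ is piecewise polynomial in the entries of $\mathbf{w}^{(r)}$ and $\mathbf{w}^{(l)}$.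
   Context: $\mathrm{GW}(K)$ is the Grothendieck–Witt ring of $K$, $\langle c\rangle$ the class of the form $(x,y)\mapsto cxy$ on $K$, $\mathbb{H}=\langle1\rangle+\langle-1\rangle$. Piecewise polynomial means: the ambient space can be divided into finitely many (relatively open) polyhedral cells such that on the points of $H$ in each cell the function agrees with a polynomial in the entries of $\mathbf{w}^{(r)},\mathbf{w}^{(l)}$. Floor diagrams. A floor diagram $\mathcal{D}=(\Gamma,w)$ is a graph $\Gamma$ without loops (multiple edges allowed) on the vertex set $\{1,\dots,a\}$, each edge oriented towards its larger vertex, with weights $w:E(\Gamma)\to\mathbb{Z}_{\ge1}$, such that at every vertex $v$ the divergence $\mathrm{div}(v)=\sum_{\text{incoming }e}w(e)-\sum_{\text{outgoing }e}w(e)$ is at most $k$. Here floor diagrams are connected; the genus is the first Betti number of $\Gamma$. They are considered up to weight-preserving isomorphism fixing the vertices. Markings. A marking $\mathcal{D}'$ of $\mathcal{D}$ of degree $\Delta_k(\mathbf{w}^{(r)},\mathbf{w}^{(l)},a)$ arises as follows. Call the vertices of $\mathcal{D}$ white. (1) Subdivide each edge of $\mathcal{D}$ by a black vertex; both new edges inherit weight and orientation. (2) For each $i=1,\dots,\ell_l$ add a black vertex and an edge of weight $\mathbf{w}^{(l)}_i$ from it to some white vertex; for each $j=1,\dots,\ell_r$ add a black vertex and an edge of weight $\mathbf{w}^{(r)}_j$ from some white vertex to it; this is done so that in the end every white vertex has divergence exactly $k$. (3) Extend the total order on white vertices to a total order on all vertices compatible with the orientation of the edges. Two markings are equivalent if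 there is an isomorphism of the underlying graphs respecting weights and total orders and fixing the white vertices. $\nu(\mathcal{D})$ is the number of markings up to equivalence. Multiplicity. An edge $e$ of weight $w$ has $\mathrm{mult}_{\mathbb{A}^1}(e)=\frac{w-1}{2}\mathbb{H}+\langle w\rangle$ if $w$ is odd and $\frac w2\mathbb{H}$ if $w$ is even. $\mathrm{mult}_{\mathbb{A}^1}(\mathcal{D})=\prod_e\mathrm{mult}_{\mathbb{A}^1}(e)$ over all edges $e$ of a marking $\mathcal{D}'$ of $\mathcal{D}$; thus each edge of $\mathcal{D}$ contributes twice and each edge added in step (2) once. Finally $N^{\mathrm{floor}}_{\mathbb{A}^1}(\Delta_k(\mathbf{w}^{(r)},\mathbf{w}^{(l)},a),g)=\sum_{\mathcal{D}}\mathrm{mult}_{\mathbb{A}^1}(\mathcal{D})\,\nu(\mathcal{D})$ over all floor diagrams of genus $g$. *)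

(* Defs.v *)
From HB Require Import structures.
From mathcomp Require Import all_boot all_order all_algebra.
From mathcomp Require Import generic_quotient boolp.
From mathcomp Require Import perm mxtens.
From mathcomp Require Import all_classical reals finmap multiset.
From mathcomp Require mpoly.
From mathcomp Require Import ring.
Set Implicit Arguments. Unset Strict Implicit. Unset Printing Implicit Defensive.
Import Order.TTheory GRing.Theory Num.Theory.
Local Open Scope ring_scope.
Local Open Scope quotient_scope.

(* Group completion of a commutative semiring, x : S * S standing for x.1 - x.2. *)
Section GrothendieckRing.
Variable S : comPzSemiRingType.
Implicit Types x y z : S * S.

Definition groth_eq x y : bool :=
  `[< exists c, x.1 + y.2 + c = y.1 + x.2 + c >].

Lemma groth_eq_refl : reflexive groth_eq.
Proof. by move=> x; apply/asboolP; exists 0. Qed.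

Lemma groth_eq_sym : symmetric groth_eq.
Proof. by move=> x y; apply/asboolP/asboolP => -[c]; exists c. Qed.

Lemma groth_eq_trans : transitive groth_eq.
Proof.
move=> y x z /asboolP[c xy] /asboolP[d yz]; apply/asboolP.
exists (y.1 + y.2 + c + d).
transitivity ((x.1 + y.2 + c) + (y.1 + z.2 + d)); first by ring.
by rewrite xy yz; ring.
Qed.

Canonical groth_equiv := EquivRel groth_eq groth_eq_refl groth_eq_sym groth_eq_trans.

Definition groth := {eq_quot groth_equiv}.
HB.instance Definition _ := Choice.on groth.
HB.instance Definition _ := EqQuotient.on groth.

Definition groth_class : S * S -> groth := \pi_groth.

Lemma groth_eqP x y :
  reflect (exists c, x.1 + y.2 + c = y.1 + x.2 + c) (groth_class x == groth_class y).
Proof. by rewrite eqmodE; apply: asboolP. Qed.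

Lemma groth_ind (P : groth -> Prop) : (forall x, P (groth_class x)) -> forall u, P u.
Proof. exact: quotW. Qed.

Definition groth_zero : groth := groth_class (0, 0).
Definition groth_one : groth := groth_class (1, 0).
Definition groth_opp (u : groth) : groth := groth_class ((repr u).2, (repr u).1).
Definition groth_add (u v : groth) : groth :=
  groth_class ((repr u).1 + (repr v).1, (repr u).2 + (repr v).2).
Definition groth_mul (u v : groth) : groth :=
  groth_class ((repr u).1 * (repr v).1 + (repr u).2 * (repr v).2,
       (repr u).1 * (repr v).2 + (repr u).2 * (repr v).1).

Lemma groth_reprP x : exists c,
  (repr (groth_class x)).1 + x.2 + c = x.1 + (repr (groth_class x)).2 + c.
Proof. by apply/groth_eqP; rewrite /groth_class reprK. Qed.

Lemma groth_oppE x : groth_opp (groth_class x) = groth_class (x.2, x.1).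
Proof.
have [c e] := groth_reprP x; apply/eqP/groth_eqP; exists c => /=.
by rewrite addrC [RHS]addrC [_ + x.1]addrC [_ + (repr _).1]addrC !(addrC c) e.
Qed.

Lemma groth_addE x y : groth_add (groth_class x) (groth_class y) = groth_class (x.1 + y.1, x.2 + y.2).
Proof.
have [c ex] := groth_reprP x; have [d ey] := groth_reprP y.
apply/eqP/groth_eqP; exists (c + d) => /=.
move: (repr (groth_class x)) (repr (groth_class y)) ex ey => x' y' ex ey.
transitivity ((x'.1 + x.2 + c) + (y'.1 + y.2 + d)); first by ring.
by rewrite ex ey; ring.
Qed.

Lemma groth_mulE x y : groth_mul (groth_class x) (groth_class y) =
  groth_class (x.1 * y.1 + x.2 * y.2, x.1 * y.2 + x.2 * y.1).
Proof.
have [c ex] := groth_reprP x; have [d ey] := groth_reprP y.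
rewrite /groth_mul; move: (repr (groth_class x)) (repr (groth_class y)) ex ey => x' y' ex ey.
transitivity (groth_class (x'.1 * y.1 + x'.2 * y.2, x'.1 * y.2 + x'.2 * y.1)).
  apply/eqP/groth_eqP; exists ((x'.1 + x'.2) * d) => /=.
  transitivity (x'.1 * (y'.1 + y.2 + d) + x'.2 * (y.1 + y'.2 + d)); first by ring.
  transitivity (x'.1 * (y.1 + y'.2 + d) + x'.2 * (y'.1 + y.2 + d)); last by ring.
  by rewrite ey.
apply/eqP/groth_eqP; exists ((y.1 + y.2) * c) => /=.
transitivity (y.1 * (x'.1 + x.2 + c) + y.2 * (x.1 + x'.2 + c)); first by ring.
transitivity (y.1 * (x.1 + x'.2 + c) + y.2 * (x'.1 + x.2 + c)); last by ring.
by rewrite ex.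
Qed.

Lemma groth_addA : associative groth_add.
Proof.
by elim/groth_ind=> x; elim/groth_ind=> y; elim/groth_ind=> z; rewrite !groth_addE /= !addrA.
Qed.
Lemma groth_addC : commutative groth_add.
Proof.
by elim/groth_ind=> x; elim/groth_ind=> y; rewrite !groth_addE [y.1 + _]addrC [y.2 + _]addrC.
Qed.
Lemma groth_add0 : left_id groth_zero groth_add.
Proof. by elim/groth_ind=> -[x y]; rewrite groth_addE /= !add0r. Qed.
Lemma groth_addN : left_inverse groth_zero groth_opp groth_add.
Proof.
elim/groth_ind=> x; rewrite groth_oppE groth_addE.
by apply/eqP/groth_eqP; exists 0 => /=; ring.
Qed.
HB.instance Definition _ :=
  GRing.isZmodule.Build groth groth_addA groth_addC groth_add0 groth_addN.

Lemma groth_mulA : associative groth_mul.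
Proof.
elim/groth_ind=> x; elim/groth_ind=> y; elim/groth_ind=> z; rewrite !groth_mulE /=.
by congr (groth_class (_, _)); ring.
Qed.
Lemma groth_mulC : commutative groth_mul.
Proof.
by elim/groth_ind=> x; elim/groth_ind=> y; rewrite !groth_mulE; congr (groth_class (_, _)); ring.
Qed.
Lemma groth_mul1 : left_id groth_one groth_mul.
Proof.
by elim/groth_ind=> -[x y]; rewrite groth_mulE; congr (groth_class (_, _)) => /=; ring.
Qed.
Lemma groth_mulDl : left_distributive groth_mul groth_add.
Proof.
elim/groth_ind=> x; elim/groth_ind=> y; elim/groth_ind=> z; rewrite !(groth_mulE, groth_addE) /=.
by congr (groth_class (_, _)); ring.
Qed.
HB.instance Definition _ :=
  GRing.Zmodule_isComPzRing.Build groth groth_mulA groth_mulC groth_mul1 groth_mulDl.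

Definition to_groth (s : S) : groth := groth_class (s, 0).

End GrothendieckRing.

(* Nondegenerate symmetric bilinear forms on K^n, given by their Gram matrices;
   the sum is the orthogonal sum and the product the tensor product. *)
Section SymmetricForms.
Variable K : fieldType.

Definition gram (n : nat) := {A : 'M[K]_n | (A^T == A) && (A \in unitmx)}.
Definition symform := {n : nat & gram n}.
HB.instance Definition _ := Choice.on symform.

Definition rk (q : symform) : nat := tag q.
Definition mx_of (q : symform) : 'M[K]_(rk q) := val (tagged q).

(* P is square and invertible: isometric forms have the same rank. *)
Definition isometric (q r : symform) : Prop :=
  exists2 P : 'M[K]_(rk q, rk r), row_free P && row_full P &
    mx_of q = P *m mx_of r *m P^T.

Definition mk_form n (A : 'M[K]_n) (sA : A^T = A) (uA : A \in unitmx) : symform :=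
  Tagged gram (exist (fun A : 'M_n => (A^T == A) && (A \in unitmx)) A
    (introT andP (conj (introT eqP sA) uA))).

Lemma mx_of_sym q : (mx_of q)^T = mx_of q.
Proof. by have /andP[/eqP] := valP (tagged q). Qed.
Lemma mx_of_unit q : mx_of q \in unitmx.
Proof. by have /andP[] := valP (tagged q). Qed.

Lemma isometricP q r : isometric q r <->
  exists (P : 'M[K]_(rk q, rk r)) (Q : 'M[K]_(rk r, rk q)),
    [/\ P *m Q = 1%:M, Q *m P = 1%:M & mx_of q = P *m mx_of r *m P^T].
Proof.
split=> [[P /andP[/row_freeP[Q PQ] /row_fullP[Q' QP]] e]|[P [Q [PQ QP e]]]].
  exists P, Q; split=> //; rewrite -QP; congr (_ *m P).
  by rewrite -[Q]mul1mx -QP -mulmxA PQ mulmx1.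
exists P => //; apply/andP; split; [apply/row_freeP|apply/row_fullP]; by exists Q.
Qed.

Lemma isometric_refl q : isometric q q.
Proof.
by apply/isometricP; exists 1%:M, 1%:M; rewrite trmx1 !mulmx1 mul1mx.
Qed.
Lemma isometric_sym q r : isometric q r -> isometric r q.
Proof.
move=> /isometricP[P [Q [PQ QP e]]]; apply/isometricP; exists Q, P; split=> //.
by rewrite e !mulmxA QP mul1mx -mulmxA -trmx_mul QP trmx1 mulmx1.
Qed.
Lemma isometric_trans q r s : isometric q r -> isometric r s -> isometric q s.
Proof.
move=> /isometricP[P [Q [PQ QP e]]] /isometricP[P' [Q' [PQ' QP' e']]].
apply/isometricP; exists (P *m P'), (Q' *m Q); split.
- by rewrite mulmxA -(mulmxA P) PQ' mulmx1.
- by rewrite mulmxA -(mulmxA Q') QP mulmx1.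
- by rewrite e e' trmx_mul !mulmxA.
Qed.

Lemma isometric_reindex (q r : symform) (I : finType)
    (e : I -> 'I_(rk q)) (f : I -> 'I_(rk r)) :
  injective e -> injective f -> rk q = #|I| -> rk r = #|I| ->
  (forall x y, mx_of q (e x) (e y) = mx_of r (f x) (f y)) -> isometric q r.
Proof.
move=> ie jf ce cf E.
have [e' eK e'K] : bijective e by apply: inj_card_bij => //; rewrite card_ord ce.
have [f' fK f'K] : bijective f by apply: inj_card_bij => //; rewrite card_ord cf.
have sel m n (g : 'I_m -> 'I_n) (C : 'M[K]_n) i j :
    ((\matrix_(a, b) (g a == b)%:R) *m C) i j = C (g i) j.
  rewrite mxE (bigD1 (g i)) //= mxE eqxx mul1r big1 ?addr0// => k nk.
  by rewrite mxE eq_sym (negPf nk) mul0r.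
apply/isometricP.
exists (\matrix_(a, b) (f (e' a) == b)%:R), (\matrix_(a, b) (e (f' a) == b)%:R); split.
- apply/matrixP=> i j; rewrite mxE (bigD1 (f (e' i))) //= !mxE eqxx mul1r fK e'K.
  by rewrite big1 ?addr0// => k nk; rewrite mxE eq_sym (negPf nk) mul0r.
- apply/matrixP=> i j; rewrite mxE (bigD1 (e (f' i))) //= !mxE eqxx mul1r eK f'K.
  by rewrite big1 ?addr0// => k nk; rewrite mxE eq_sym (negPf nk) mul0r.
apply/matrixP=> i j; rewrite -[LHS](congr2 (mx_of q) (e'K i) (e'K j)) E.
rewrite [RHS]mxE (bigD1 (f (e' j))) //= sel !mxE eqxx mulr1.
by rewrite big1 ?addr0// => k nk; rewrite !mxE eq_sym (negPf nk) mulr0.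
Qed.

Lemma sum_sym q r :
  (block_mx (mx_of q) 0 0 (mx_of r))^T = block_mx (mx_of q) 0 0 (mx_of r).
Proof. by rewrite tr_block_mx !trmx0 !mx_of_sym. Qed.
Lemma sum_unit q r : block_mx (mx_of q) 0 0 (mx_of r) \in unitmx.
Proof. by rewrite unitmxE det_ublock unitrM -!unitmxE !mx_of_unit. Qed.
Definition form_add q r : symform := mk_form (sum_sym q r) (sum_unit q r).

Lemma tens1mx1 m n : (1%:M : 'M[K]_m) *t (1%:M : 'M[K]_n) = 1%:M.
Proof.
apply/matrixP=> i j; case: (mxtens_indexP i) => a b; case: (mxtens_indexP j) => c d.
rewrite tensmxE !mxE -natrM mulnb; congr (nat_of_bool _)%:R.
by rewrite (can_eq (@mxtens_indexK _ _)) xpair_eqE.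
Qed.

Lemma mxtens_index_inj m n (i i' : 'I_m) (j j' : 'I_n) :
  mxtens_index (i, j) = mxtens_index (i', j') -> i = i' /\ j = j'.
Proof.
move/(can_inj (@mxtens_indexK m n)) => E.
by split; [exact: (congr1 (fun x => x.1) E) | exact: (congr1 (fun x => x.2) E)].
Qed.

Lemma mul_sym q r : (mx_of q *t mx_of r)^T = mx_of q *t mx_of r.
Proof. by rewrite trmx_tens !mx_of_sym. Qed.
Lemma mul_unit q r : mx_of q *t mx_of r \in unitmx.
Proof.
suff /mulmx1_unit[] : (mx_of q *t mx_of r) *m (invmx (mx_of q) *t invmx (mx_of r)) = 1%:M by [].
by rewrite tensmx_mul !mulmxV ?mx_of_unit// tens1mx1.
Qed.
Definition form_mul q r : symform := mk_form (mul_sym q r) (mul_unit q r).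

Lemma unitmx00 : (0 : 'M[K]_0) \in unitmx.
Proof. by rewrite unitmxE det_mx00 unitr1. Qed.

Definition form0 : symform :=
  @mk_form 0 0 (trmx0 _ _ _) unitmx00.
Definition form1 : symform := @mk_form 1 1%:M (trmx1 _ _) (unitmx1 _ _).

Lemma isometric_add q q' r r' :
  isometric q q' -> isometric r r' -> isometric (form_add q r) (form_add q' r').
Proof.
move=> /isometricP[P [Q [PQ QP e]]] /isometricP[P' [Q' [PQ' QP' e']]].
apply/isometricP; exists (block_mx P 0 0 P'), (block_mx Q 0 0 Q'); split.
- by rewrite mulmx_block !(mul0mx, mulmx0, addr0, add0r) PQ PQ' -scalar_mx_block.
- by rewrite mulmx_block !(mul0mx, mulmx0, addr0, add0r) QP QP' -scalar_mx_block.
- have -> : mx_of (form_add q r) = block_mx (mx_of q) 0 0 (mx_of r) by [].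
  have -> : mx_of (form_add q' r') = block_mx (mx_of q') 0 0 (mx_of r') by [].
  rewrite (@tr_block_mx _ (rk q) (rk r) (rk q') (rk r')) !trmx0 e e'.
  by rewrite !mulmx_block !(mul0mx, mulmx0, addr0, add0r).
Qed.

Lemma isometric_mul q q' r r' :
  isometric q q' -> isometric r r' -> isometric (form_mul q r) (form_mul q' r').
Proof.
move=> /isometricP[P [Q [PQ QP e]]] /isometricP[P' [Q' [PQ' QP' e']]].
apply/isometricP; exists (P *t P'), (Q *t Q'); split.
- by rewrite tensmx_mul PQ PQ' tens1mx1.
- by rewrite tensmx_mul QP QP' tens1mx1.
- have -> : mx_of (form_mul q r) = mx_of q *t mx_of r by [].
  have -> : mx_of (form_mul q' r') = mx_of q' *t mx_of r' by [].
  by rewrite trmx_tens !tensmx_mul e e'.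
Qed.

Lemma form_addEl q r i j : mx_of (form_add q r) (lshift _ i) (lshift _ j) = mx_of q i j.
Proof. exact: block_mxEul. Qed.
Lemma form_addElr q r i j : mx_of (form_add q r) (lshift _ i) (rshift _ j) = 0.
Proof. by rewrite [LHS]block_mxEur mxE. Qed.
Lemma form_addErl q r i j : mx_of (form_add q r) (rshift _ i) (lshift _ j) = 0.
Proof. by rewrite [LHS]block_mxEdl mxE. Qed.
Lemma form_addEr q r i j : mx_of (form_add q r) (rshift _ i) (rshift _ j) = mx_of r i j.
Proof. exact: block_mxEdr. Qed.
Definition form_addE := (form_addEl, form_addElr, form_addErl, form_addEr).
Lemma form_mulE q r i j k l :
  mx_of (form_mul q r) (mxtens_index (i, j)) (mxtens_index (k, l)) = mx_of q i k * mx_of r j l.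
Proof. exact: tensmxE. Qed.

Lemma form_addA q r s : isometric (form_add q (form_add r s)) (form_add (form_add q r) s).
Proof.
pose e (x : 'I_(rk q) + ('I_(rk r) + 'I_(rk s))) : 'I_(rk (form_add q (form_add r s))) :=
  match x with inl i => lshift _ i | inr y => rshift _ (unsplit y) end.
pose f (x : 'I_(rk q) + ('I_(rk r) + 'I_(rk s))) : 'I_(rk (form_add (form_add q r) s)) :=
  match x with inl i => lshift _ (lshift _ i) | inr (inl i) => lshift _ (rshift _ i)
  | inr (inr i) => rshift _ i end.
apply: (@isometric_reindex _ _ _ e f).
- by apply: (can_inj (g := fun i => match fintype.split i with inl i => inl i | inr j => inr (fintype.split j) end))
    => -[i|y] /=; rewrite ?(unsplitK (inl _)) ?(unsplitK (inr _)) ?unsplitK.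
- apply: (can_inj (g := fun i => match fintype.split i with inl i =>
    match fintype.split i with inl i => inl i | inr j => inr (inl j) end | inr j => inr (inr j) end))
    => -[i|[i|i]] /=; by rewrite ?(unsplitK (inl _), unsplitK (inr _)).
- by rewrite !card_sum !card_ord.
- by rewrite !card_sum !card_ord addnA.
by move=> [i|[i|i]] [j|[j|j]]; rewrite /e /f; lazy beta iota; rewrite ?form_addE //; lazy beta iota delta [unsplit]; rewrite !form_addE.
Qed.

Lemma form_addC q r : isometric (form_add q r) (form_add r q).
Proof.
pose f (x : 'I_(rk q) + 'I_(rk r)) : 'I_(rk (form_add r q)) :=
  match x with inl i => rshift _ i | inr i => lshift _ i end.
apply: (@isometric_reindex (form_add q r) (form_add r q) _ (@unsplit _ _) f).
- exact: (can_inj unsplitK).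
- apply: (can_inj (g := fun i => match fintype.split i with inl i => inr i | inr j => inl j end)).
  by case=> i; rewrite ?(unsplitK (inl _), unsplitK (inr _)).
- by rewrite !card_sum !card_ord.
- by rewrite !card_sum !card_ord addnC.
by move=> [i|i] [j|j]; rewrite /f; lazy beta iota delta [unsplit]; rewrite !form_addE.
Qed.

Lemma form_add0 q : isometric (form_add form0 q) q.
Proof.
apply: (@isometric_reindex (form_add form0 q) q 'I_(rk q) (@rshift 0 (rk q)) id) => //.
- exact: rshift_inj.
- by rewrite card_ord.
- by rewrite card_ord.
exact: (@form_addEr form0 q).
Qed.

Lemma form_mulA q r s : isometric (form_mul q (form_mul r s)) (form_mul (form_mul q r) s).
Proof.
pose e (x : 'I_(rk q) * ('I_(rk r) * 'I_(rk s))) : 'I_(rk (form_mul q (form_mul r s))) :=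
  mxtens_index (x.1, mxtens_index (x.2.1, x.2.2)).
pose f (x : 'I_(rk q) * ('I_(rk r) * 'I_(rk s))) : 'I_(rk (form_mul (form_mul q r) s)) :=
  mxtens_index (mxtens_index (x.1, x.2.1), x.2.2).
apply: (@isometric_reindex _ _ _ e f).
- by move=> [i [j k]] [i' [j' k']] /mxtens_index_inj /=[-> /mxtens_index_inj /=[-> ->]].
- by move=> [i [j k]] [i' [j' k']] /mxtens_index_inj /=[/mxtens_index_inj /=[-> ->] ->].
- by rewrite !card_prod !card_ord.
- by rewrite !card_prod !card_ord mulnA.
by move=> x y; rewrite /e /f !form_mulE mulrA.
Qed.

Lemma form_mulC q r : isometric (form_mul q r) (form_mul r q).
Proof.
pose e (x : 'I_(rk q) * 'I_(rk r)) : 'I_(rk (form_mul q r)) := mxtens_index (x.1, x.2).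
pose f (x : 'I_(rk q) * 'I_(rk r)) : 'I_(rk (form_mul r q)) := mxtens_index (x.2, x.1).
apply: (@isometric_reindex _ _ _ e f).
- by move=> [i j] [i' j'] /mxtens_index_inj /=[-> ->].
- by move=> [i j] [i' j'] /mxtens_index_inj /=[-> ->].
- by rewrite !card_prod !card_ord.
- by rewrite !card_prod !card_ord mulnC.
by move=> x y; rewrite /e /f !form_mulE mulrC.
Qed.

Lemma form_mul1 q : isometric (form_mul form1 q) q.
Proof.
pose e (i : 'I_(rk q)) : 'I_(rk (form_mul form1 q)) := mxtens_index (ord0 : 'I_1, i).
apply: (@isometric_reindex _ _ _ e id) => //.
- by move=> i j /mxtens_index_inj /=[].
- by rewrite card_ord /= mul1n.
- by rewrite card_ord.
by move=> i j; rewrite /e (@form_mulE form1 q) [mx_of form1 _ _]mxE eqxx mul1r.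
Qed.

Lemma form_mul0 q : isometric (form_mul form0 q) form0.
Proof.
apply: (@isometric_reindex _ _ void (fun x => match x with end) (fun x => match x with end)).
- by case.
- by case.
- by rewrite card_void.
- by rewrite card_void.
by case.
Qed.

Lemma form_mulDl q r s :
  isometric (form_mul (form_add q r) s) (form_add (form_mul q s) (form_mul r s)).
Proof.
pose e (x : ('I_(rk q) + 'I_(rk r)) * 'I_(rk s)) :
    'I_(rk (form_mul (form_add q r) s)) := mxtens_index (unsplit x.1, x.2).
pose f (x : ('I_(rk q) + 'I_(rk r)) * 'I_(rk s)) :
    'I_(rk (form_add (form_mul q s) (form_mul r s))) :=
  match x.1 with inl i => lshift _ (mxtens_index (i, x.2))
  | inr i => rshift _ (mxtens_index (i, x.2)) end.
apply: (@isometric_reindex _ _ _ e f).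
- by move=> [i j] [i' j'] /mxtens_index_inj /=[/(can_inj (@unsplitK _ _)) -> ->].
- move=> [[i|i] j] [[i'|i'] j'] /=.
  + by move=> /lshift_inj/mxtens_index_inj /=[-> ->].
  + by move/eqP; rewrite eq_lrshift.
  + by move/eqP; rewrite eq_rlshift.
  + by move=> /rshift_inj/mxtens_index_inj /=[-> ->].
- by rewrite !(card_prod, card_sum) !card_ord.
- by rewrite !(card_prod, card_sum) !card_ord mulnDl.
move=> [x j] [x' j']; rewrite /e (@form_mulE (form_add q r) s) /f; lazy beta iota delta [fst snd].
case: x x' => i [] i'; lazy beta iota delta [unsplit]; rewrite ?form_addE ?mul0r //.
- by rewrite form_mulE.
- by rewrite form_mulE.
Qed.

Definition isom_rel q r := `[< isometric q r >].
Lemma isom_rel_refl : reflexive isom_rel.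
Proof. by move=> q; apply/asboolP; exact: isometric_refl. Qed.
Lemma isom_rel_sym : symmetric isom_rel.
Proof. by move=> q r; apply/asboolP/asboolP; exact: isometric_sym. Qed.
Lemma isom_rel_trans : transitive isom_rel.
Proof.
by move=> r q s /asboolP qr /asboolP rs; apply/asboolP; exact: isometric_trans qr rs.
Qed.
Canonical isom_equiv := EquivRel isom_rel isom_rel_refl isom_rel_sym isom_rel_trans.

Definition isoclass := {eq_quot isom_equiv}.
HB.instance Definition _ := Choice.on isoclass.
HB.instance Definition _ := EqQuotient.on isoclass.

Definition iso_class : symform -> isoclass := \pi_isoclass.
Lemma isoclass_ind (P : isoclass -> Prop) : (forall q, P (iso_class q)) -> forall u, P u.
Proof. exact: quotW. Qed.

Lemma isoclassP q r : isometric q r <-> iso_class q = iso_class r.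
Proof.
split=> [qr|/eqP]; last by rewrite eqmodE => /asboolP.
by apply/eqP; rewrite eqmodE; apply/asboolP.
Qed.

Definition isoclass_zero : isoclass := iso_class form0.
Definition isoclass_one : isoclass := iso_class form1.
Definition isoclass_add (u v : isoclass) : isoclass := iso_class (form_add (repr u) (repr v)).
Definition isoclass_mul (u v : isoclass) : isoclass := iso_class (form_mul (repr u) (repr v)).

Lemma isoclass_addE q r : isoclass_add (iso_class q) (iso_class r) = iso_class (form_add q r).
Proof. by apply/isoclassP/isometric_add; apply/isoclassP; rewrite /iso_class reprK. Qed.
Lemma isoclass_mulE q r : isoclass_mul (iso_class q) (iso_class r) = iso_class (form_mul q r).
Proof. by apply/isoclassP/isometric_mul; apply/isoclassP; rewrite /iso_class reprK. Qed.

Lemma isoclass_addA : associative isoclass_add.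
Proof.
elim/isoclass_ind=> q; elim/isoclass_ind=> r; elim/isoclass_ind=> s; rewrite !isoclass_addE.
exact/isoclassP/form_addA.
Qed.
Lemma isoclass_addC : commutative isoclass_add.
Proof.
by elim/isoclass_ind=> q; elim/isoclass_ind=> r; rewrite !isoclass_addE; exact/isoclassP/form_addC.
Qed.
Lemma isoclass_add0 : left_id isoclass_zero isoclass_add.
Proof. by elim/isoclass_ind=> q; rewrite isoclass_addE; exact/isoclassP/form_add0. Qed.
HB.instance Definition _ :=
  GRing.isNmodule.Build isoclass isoclass_addA isoclass_addC isoclass_add0.

Lemma isoclass_mulA : associative isoclass_mul.
Proof.
elim/isoclass_ind=> q; elim/isoclass_ind=> r; elim/isoclass_ind=> s; rewrite !isoclass_mulE.
exact/isoclassP/form_mulA.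
Qed.
Lemma isoclass_mulC : commutative isoclass_mul.
Proof.
by elim/isoclass_ind=> q; elim/isoclass_ind=> r; rewrite !isoclass_mulE; exact/isoclassP/form_mulC.
Qed.
Lemma isoclass_mul1 : left_id isoclass_one isoclass_mul.
Proof. by elim/isoclass_ind=> q; rewrite isoclass_mulE; exact/isoclassP/form_mul1. Qed.
Lemma isoclass_mul0 : left_zero isoclass_zero isoclass_mul.
Proof. by elim/isoclass_ind=> q; rewrite isoclass_mulE; exact/isoclassP/form_mul0. Qed.
Lemma isoclass_mulDl : left_distributive isoclass_mul isoclass_add.
Proof.
elim/isoclass_ind=> q; elim/isoclass_ind=> r; elim/isoclass_ind=> s; rewrite !(isoclass_mulE, isoclass_addE).
exact/isoclassP/form_mulDl.
Qed.
HB.instance Definition _ := GRing.Nmodule_isComPzSemiRing.Build isoclass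
  isoclass_mulA isoclass_mulC isoclass_mul1 isoclass_mulDl isoclass_mul0.

End SymmetricForms.

Definition GW (K : fieldType) := groth (isoclass K).
HB.instance Definition _ (K : fieldType) := GRing.ComPzRing.on (GW K).

Definition gw_class (K : fieldType) (q : symform K) : GW K := to_groth (iso_class q).

(* <c>; the junk value at c = 0, where the form is degenerate, is 0. *)
Definition gw_unary (K : fieldType) (c : K) : GW K :=
  if insub (c%:M : 'M_1) is Some A then gw_class (Tagged (gram K) A) else 0.

Definition hyperbolic (K : fieldType) : GW K := gw_unary 1 + gw_unary (-1).

Section FloorDiagrams.
Variable a : nat.

(* (source, target, weight); the vertex set {1..a} is 'I_a. *)
Definition edge : Type := ('I_a * 'I_a * nat)%type.
HB.instance Definition _ := Choice.on edge.
Definition src (e : edge) : 'I_a := e.1.1.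
Definition tgt (e : edge) : 'I_a := e.1.2.
Definition wt (e : edge) : nat := e.2.

Implicit Type D : seq edge.

Definition edge_div D (v : 'I_a) : int :=
  \sum_(e <- D | tgt e == v) (wt e)%:Z - \sum_(e <- D | src e == v) (wt e)%:Z.

Definition adjacent D : rel 'I_a := fun u v =>
  has (fun e => (src e == u) && (tgt e == v) || (src e == v) && (tgt e == u)) D.

Definition floor_diagram (k : nat) D : bool :=
  [&& all (fun e => (src e < tgt e)%N && (0 < wt e)%N) D,
      [forall u, forall v, connect (adjacent D) u v] &
      [forall v, edge_div D v <= k%:Z]].

(* First Betti number, #edges + #components - #vertices. *)
Definition genus D : nat := (size D + n_comp (adjacent D) predT - a)%N.

(* Two weighted oriented graphs on 'I_a are isomorphic by an isomorphism fixing
   the vertices iff they have the same multiset of edges. *)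
Definition floor_diagrams (k g : nat) : set {mset edge}%mset :=
  [set D : {mset edge}%mset | floor_diagram k D /\ genus D = g]%classic.

Lemma edge_wt_bound k D (e : edge) :
  floor_diagram k D -> e \in D -> (wt e <= k * a)%N.
Proof.
case/and3P=> /allP Dpos _ /forallP Ddiv eD.
pose up (v : 'I_a) := (tgt e <= v)%N.
have le1 : \sum_(v | up v) edge_div D v <= (k * a)%:Z.
  apply: (@le_trans _ _ (\sum_(v : 'I_a | up v) k%:Z)); first exact: ler_sum.
  rewrite sumr_const pmulrn mulrzz -PoszM lez_nat leq_mul2l; apply/orP; right.
  by rewrite -[X in (_ <= X)%N](card_ord a) max_card.
rewrite -lez_nat; apply: le_trans le1.
have fib (h : edge -> 'I_a) : \sum_(v | up v) \sum_(e <- D | h e == v) (wt e)%:Z =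
    \sum_(e <- D) (if up (h e) then (wt e)%:Z else 0).
  rewrite (exchange_big_dep xpredT) //=; apply: eq_bigr => e' _.
  under eq_bigl do rewrite andbC eq_sym.
  by rewrite big_mkcondr big_pred1_eq.
rewrite big_split /= sumrN !fib -sumrB (big_rem e) //=.
have [srclt _] := andP (Dpos _ eD).
rewrite /up leqnn leqNgt srclt /= subr0 lerDl big_seq; apply: sumr_ge0 => e' /mem_rem e'D.
have [lt _] := andP (Dpos _ e'D).
case: ifP => [_|/negbT nt]; first by case: ifP; rewrite ?subrr ?subr0.
by rewrite ifN ?subr0 // -ltnNge (ltn_trans lt) // ltnNge.
Qed.

(* Hence the sums over floor_diagrams below, which are 0 by convention on an
   infinite support, are genuine finite sums. *)
Lemma finite_floor_diagrams k g : finite_set (floor_diagrams k g).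
Proof.
pose S := (g + a).-bseq ('I_a * 'I_a * 'I_(k * a).+1)%type.
pose F (s : S) : {mset edge}%mset := seq_mset [seq (x.1, val x.2) : edge | x <- s].
apply: (@sub_finite_set _ _ (F @` setT)%classic); last exact/finite_image/finite_finset.
move=> D [fD gD] /=.
have sD : (size D <= g + a)%N by move: gD; rewrite /genus => <-; rewrite addnC -leq_subLR leq_sub2r // leq_addr.
pose s := [seq (e.1, inord (wt e)) : 'I_a * 'I_a * 'I_(k * a).+1 | e <- enum_mset D].
have ss : (size s <= g + a)%N by rewrite size_map.
exists (Bseq ss) => //; rewrite /F /= -map_comp.
rewrite (_ : map _ _ = enum_mset D); first exact: seq_mset_id.
rewrite -[RHS]map_id; apply/eq_in_map => e eD /=.
by rewrite inordK ?ltnS ?(edge_wt_bound fD eD) //; case: e {eD}.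
Qed.

Section Markings.
Variables (lr ll : nat) (wr : 'I_lr -> nat) (wl : 'I_ll -> nat) (D : seq edge).

(* White vertices, then the black vertices: one for each edge of D, each left
   end and each right end *)
Definition mvertex : Type := ('I_a + ('I_(size D) + ('I_ll + 'I_lr)))%type.
HB.instance Definition _ := Finite.on mvertex.

(* The attachment of the left and right ends to white vertices, and the total
   order, encoded by the position of each vertex. *)
Definition premarking : Type :=
  ({ffun 'I_ll -> 'I_a} * {ffun 'I_lr -> 'I_a} * {ffun mvertex -> 'I_#|{: mvertex}|})%type.
HB.instance Definition _ := Finite.on premarking.

Definition nthe (i : 'I_(size D)) : edge := tnth (in_tuple D) i.

Implicit Type M : premarking.
Definition att_l M : 'I_ll -> 'I_a := M.1.1.
Definition att_r M : 'I_lr -> 'I_a := M.1.2.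
Definition pos M : mvertex -> 'I_#|{: mvertex}| := M.2.

(* The weight of the edge of the marking from u to v, and 0 if there is none
   (the marking has no multiple edges). *)
Definition mweight M (u v : mvertex) : nat :=
  match u, v with
  | inl x, inr (inl i) => if src (nthe i) == x then wt (nthe i) else 0
  | inr (inl i), inl x => if tgt (nthe i) == x then wt (nthe i) else 0
  | inr (inr (inl i)), inl x => if att_l M i == x then wl i else 0
  | inl x, inr (inr (inr j)) => if att_r M j == x then wr j else 0
  | _, _ => 0
  end%N.

Definition mdiv M (v : mvertex) : int :=
  \sum_u (mweight M u v)%:Z - \sum_u (mweight M v u)%:Z.

Definition is_marking (k : nat) M : bool :=
  [&& [forall v : 'I_a, mdiv M (inl v) == k%:Z],
      injectiveb (pos M),
      [forall u : 'I_a, forall v : 'I_a, (u < v)%N ==> (pos M (inl u) < pos M (inl v))%N] &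
      [forall u, forall v, (0 < mweight M u v)%N ==> (pos M u < pos M v)%N]].

Definition marking_equiv : rel premarking := fun M M' =>
  [exists f : {perm mvertex},
    [&& [forall v : 'I_a, f (inl v) == inl v],
        [forall u, forall v, mweight M u v == mweight M' (f u) (f v)] &
        [forall u, forall v, (pos M u < pos M v)%N == (pos M' (f u) < pos M' (f v))%N]]].

Definition num_markings (k : nat) : nat :=
  #|equivalence_partition marking_equiv [set M | is_marking k M]|.

End Markings.
End FloorDiagrams.

Section Count.
Variables (k a g lr ll : nat) (wr : 'I_lr -> nat) (wl : 'I_ll -> nat).

Section Enriched.
Variable K : fieldType.

Definition edge_mult (w : nat) : GW K :=
  if odd w then hyperbolic K *+ w.-1./2 + gw_unary w%:R else hyperbolic K *+ w./2.

Definition diagram_mult (D : seq (edge a)) : GW K :=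
  \prod_(e <- D) edge_mult (wt e) ^+ 2 * \prod_i edge_mult (wl i) * \prod_j edge_mult (wr j).

Definition floor_count : GW K :=
  \sum_(D \in @floor_diagrams a k g) diagram_mult (enum_mset D) *+ num_markings wr wl (enum_mset D) k.

End Enriched.

(* (n, s) stands for the expression n H + \sum_(c <- s) <c>.  In GW(K) itself the
   coefficient of H is not well defined, since H = <c> + <-c> for every unit c: it
   is read off the expansion of floor_count by the rules H * H = 2 H,  H * <c> = H
   and <c> * <d> = <cd>, starting from the defining expressions of edge_mult. *)
Definition expansion : Type := (nat * seq nat)%type.

Definition exp_one : expansion := (0, [:: 1])%N.
Definition exp_mul (x y : expansion) : expansion :=
  ((x.1 * y.1).*2 + x.1 * size y.2 + size x.2 * y.1, [seq c * d | c <- x.2, d <- y.2])%N.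

Definition edge_exp (w : nat) : expansion :=
  if odd w then (w.-1./2, [:: w]) else (w./2, [::]).

Definition diagram_exp (D : seq (edge a)) : expansion :=
  exp_mul (\big[exp_mul/exp_one]_(e <- D) exp_mul (edge_exp (wt e)) (edge_exp (wt e)))
    (exp_mul (\big[exp_mul/exp_one]_i edge_exp (wl i))
             (\big[exp_mul/exp_one]_j edge_exp (wr j))).

Definition hyperbolic_coef : nat :=
  \big[addn/0%N]_(D \in @floor_diagrams a k g) (num_markings wr wl (enum_mset D) k * (diagram_exp (enum_mset D)).1)%N.

Definition odd_weights : Prop :=
  [/\ forall j, odd (wr j), forall i, odd (wl i) &
      exists b, (\sum_j wr j = b)%N /\ (\sum_i wl i = a * k + b)%N].

End Count.

Import mpoly.

Section PiecewisePolynomial.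
Variables (R : realType) (n : nat).

(* A relatively open polyhedral cell is cut out by finitely many affine equations
   and strict affine inequalities; (c, d) stands for x |-> x *m c + d. *)
Record cell := Cell {
  cell_eqs : seq ('cV[R]_n * R);
  cell_ineqs : seq ('cV[R]_n * R) }.

Definition affine (l : 'cV[R]_n * R) (x : 'rV[R]_n) : R := (x *m l.1) 0 0 + l.2.

Definition in_cell (x : 'rV[R]_n) (C : cell) : bool :=
  all (fun l => affine l x == 0) (cell_eqs C) && all (fun l => 0 < affine l x) (cell_ineqs C).

Definition piecewise_polynomial (T : Type) (H : T -> Prop)
    (pt : T -> 'rV[R]_n) (f : T -> R) : Prop :=
  exists (m : nat) (C : 'I_m -> cell),
    (forall x, exists! i, in_cell x (C i)) /\
    forall i, exists p : {mpoly R[n]},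
      forall w, H w -> in_cell (pt w) (C i) -> f w = p.@[pt w 0].

End PiecewisePolynomial.

(* Main.v *)
(* Both [edge_mult : nat -> GW K] and [edge_exp : nat -> expansion] are
   multiplicative, so a diagram D contributes [edge_mult N] and [edge_exp N], where
   N is the product of all edge weights of a marking.  Each edge of D counts twice
   in N and <c d^2> = <c>, so for odd N only the product of the end weights is left
   in the unary form, while the coefficient of H is (N - 1) / 2 or N / 2 according
   to the parity of N, which depends on D only.
   For fixed k, a, g there are finitely many diagrams whatever the end weights are,
   and whether a premarking is a marking, or two of them are equivalent, depends
   only on which of finitely many affine functions of the end weights vanish (the
   divergences minus k, the edge weights and their differences).  Hence the numbers
   of markings are constant on the cells of a hyperplane arrangement. *)
Require Import Defs.
From mathcomp Require Import all_boot all_order all_algebra.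
From mathcomp Require Import mxtens finmap multiset.
From mathcomp Require Import all_classical reals.
From mathcomp Require mpoly.
From mathcomp Require Import ring.
Import Order.TTheory GRing.Theory Num.Theory.
Set Implicit Arguments. Unset Strict Implicit. Unset Printing Implicit Defensive.
Local Open Scope ring_scope.

(** * Unary forms and the hyperbolic form in [GW K] *)

Lemma gw_classP (K : fieldType) (q r : symform K) :
  isometric q r -> gw_class q = gw_class r.
Proof. by move=> /isoclassP; rewrite /gw_class => ->. Qed.

Lemma gw_class_add (K : fieldType) (q r : symform K) :
  gw_class q + gw_class r = gw_class (form_add q r).
Proof.
by rewrite [LHS]groth_addE /= addr0 [X in (X, _)]isoclass_addE.
Qed.

Lemma gw_class_mul (K : fieldType) (q r : symform K) :
  gw_class q * gw_class r = gw_class (form_mul q r).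
Proof.
rewrite [LHS]groth_mulE /= !mulr0 addr0 add0r [X in (X, _)]isoclass_mulE.
by rewrite (_ : 0 * iso_class r = 0) //; exact: mul0r.
Qed.

Lemma unary_unit (K : fieldType) (c : K) : c != 0 -> (c%:M : 'M[K]_1) \in unitmx.
Proof. by move=> c0; rewrite unitmxE det_scalar expr1 unitfE. Qed.

Definition unary_form (K : fieldType) (c : K) (c0 : c != 0) : symform K :=
  mk_form (tr_scalar_mx 1 c) (unary_unit c0).

(** Away from 0 the [insub] in [gw_unary] succeeds, so identities between unary classes reduce to
    isometries of explicit forms. *)
Lemma gw_unary_class (K : fieldType) (c : K) (c0 : c != 0) :
  gw_unary c = gw_class (unary_form c0).
Proof.
rewrite /gw_unary insubT ?unary_unit ?tr_scalar_mx ?eqxx //= => p.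
by congr (gw_class (Tagged _ _)); apply: val_inj.
Qed.

Lemma gw_unary1 (K : fieldType) : gw_unary (1 : K) = 1.
Proof.
rewrite (gw_unary_class (oner_neq0 K)); apply: gw_classP.
by apply: (@isometric_reindex _ (unary_form _) (form1 K) 'I_1 id id) => //; rewrite card_ord.
Qed.

Lemma gw_unaryM (K : fieldType) (c d : K) : c != 0 -> d != 0 ->
  gw_unary c * gw_unary d = gw_unary (c * d).
Proof.
move=> c0 d0; have cd0 : c * d != 0 by rewrite mulf_neq0.
rewrite !(gw_unary_class c0, gw_unary_class d0, gw_unary_class cd0) gw_class_mul.
apply: gw_classP.
pose e (i : 'I_1) : 'I_(rk (form_mul (unary_form c0) (unary_form d0))) :=
  mxtens_index (i, i).
apply: (@isometric_reindex _ _ (unary_form cd0) 'I_1 e id) => //.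
- by move=> i j _; rewrite !ord1.
- by rewrite card_ord.
- by rewrite card_ord.
by move=> i j; rewrite /e form_mulE !mxE !ord1 eqxx.
Qed.

(** Rescaling the basis vector by [d] is an isometry; at [c = 0] both sides are the same junk
    value. *)
Lemma gw_unary_sqr (K : fieldType) (c d : K) : d != 0 ->
  gw_unary (c * d ^+ 2) = gw_unary c.
Proof.
move=> d0; have [->|c0] := eqVneq c 0; first by rewrite mul0r.
have cd0 : c * d ^+ 2 != 0 by rewrite mulf_neq0 ?expf_neq0.
rewrite (gw_unary_class c0) (gw_unary_class cd0).
apply/gw_classP/isometricP; exists d%:M, d^-1%:M.
rewrite -!scalar_mxM mulfV ?mulVf //; split=> //.
rewrite tr_scalar_mx -scalar_mxM [LHS]/((c * d ^+ 2)%:M).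
by congr _%:M; ring.
Qed.

(* With [a = (c + 1) / 2] and [b = (c - 1) / 2] one has [a^2 - b^2 = c], so
   [[a, b], [b, a]] carries diag(1, -1) to diag(c, -c). *)
Lemma gw_unaryDN (K : fieldType) (c : K) : (2%:R : K) != 0 -> c != 0 ->
  gw_unary c + gw_unary (- c) = hyperbolic K.
Proof.
move=> two c0; have nc0 : - c != 0 by rewrite oppr_eq0.
have n1 : (-1 : K) != 0 by rewrite oppr_eq0 oner_neq0.
rewrite /hyperbolic (gw_unary_class c0) (gw_unary_class nc0).
rewrite (gw_unary_class (oner_neq0 K)) (gw_unary_class n1) !gw_class_add.
pose a : K := (c + 1) / 2%:R; pose b : K := (c - 1) / 2%:R.
have ab : a ^+ 2 - b ^+ 2 = c by rewrite /a /b; field.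
apply/gw_classP/isometricP.
exists (block_mx a%:M b%:M b%:M a%:M : 'M_(1 + 1)).
exists (block_mx (a / c)%:M (- (b / c))%:M (- (b / c))%:M (a / c)%:M : 'M_(1 + 1)).
have mxE1 (x y : K) : x = y -> (x%:M : 'M[K]_1) = y%:M by move->.
have zE (x : K) : x = 0 -> (x%:M : 'M[K]_1) = 0 by move->; rewrite raddf0.
split.
- rewrite [LHS]mulmx_block -!scalar_mxM -!raddfD /= [RHS](@scalar_mx_block _ 1 1).
  by congr block_mx; [apply: mxE1|apply: zE|apply: zE|apply: mxE1];
    rewrite -?ab; field; rewrite ab.
- rewrite [LHS]mulmx_block -!scalar_mxM -!raddfD /= [RHS](@scalar_mx_block _ 1 1).
  by congr block_mx; [apply: mxE1|apply: zE|apply: zE|apply: mxE1];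
    rewrite -?ab; field; rewrite ab.
rewrite [mx_of _ in LHS]/(block_mx c%:M 0 0 (- c)%:M).
rewrite [mx_of _ in RHS]/(block_mx 1%:M 0 0 (-1)%:M).
rewrite [(block_mx a%:M _ _ _)^T](@tr_block_mx _ 1 1 1 1) !tr_scalar_mx.
rewrite [X in _ = X *m _]mulmx_block [RHS]mulmx_block.
rewrite !mulmx0 !addr0 !add0r !mulmx1 -!scalar_mxM -!raddfD /=.
by congr block_mx; [apply: mxE1|apply/esym/zE|apply/esym/zE|apply: mxE1];
    rewrite -?ab; ring.
Qed.

Lemma hyperbolic_unary (K : fieldType) (c : K) : (2%:R : K) != 0 -> c != 0 ->
  hyperbolic K * gw_unary c = hyperbolic K.
Proof.
move=> two c0; rewrite /hyperbolic mulrDl !gw_unaryM ?oppr_eq0 ?oner_neq0 //.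
by rewrite mul1r mulN1r gw_unaryDN.
Qed.

Lemma hyperbolic_sqr (K : fieldType) : (2%:R : K) != 0 ->
  hyperbolic K * hyperbolic K = hyperbolic K *+ 2.
Proof.
move=> two; rewrite {2}/hyperbolic mulrDr.
by rewrite !hyperbolic_unary ?oppr_eq0 ?oner_neq0.
Qed.

(** * Multiplicativity of edge multiplicities and of their expansions *)

(** For m = 2x+1 and n = 2y+1 the half of mn is 2xy + x + y, which is the coefficient of H in (xH +
    <m>)(yH + <n>), because H H = 2H and H <c> = H. *)
Lemma odd_halfM m n : odd m -> odd n ->
  ((m * n)./2 = (m./2 * n./2).*2 + m./2 + n./2)%N.
Proof.
move=> om on; rewrite -{1}(odd_double_half m) -{1}(odd_double_half n) om on.
rewrite (_ : (_ * _)%N = ((m./2 * n./2).*2 + m./2 + n./2).*2.+1); last first.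
  by rewrite -addn1 -!mul2n /=; ring.
by rewrite -[_.*2.+1]/(true + _.*2)%N half_bit_double.
Qed.

Lemma even_halfM m n : ~~ odd m -> ((m * n)./2 = m./2 * n)%N.
Proof.
by move=> em; rewrite -{1}(even_halfK em) -doubleMl doubleK.
Qed.

Lemma odd_predn_half n : odd n -> n.-1./2 = n./2.
Proof. by case: n => //= n; rewrite uphalf_half => /negPf->. Qed.

(** Halving rounds down, so one coefficient of H serves both parities and only the unary term
    depends on the parity. *)
Lemma edge_multE (K : fieldType) n :
  edge_mult K n = hyperbolic K *+ n./2 + (if odd n then gw_unary n%:R else 0).
Proof. by rewrite /edge_mult; case: ifP => [/odd_predn_half->|]; rewrite ?addr0. Qed.

Lemma edge_multM (K : fieldType) m n : [pchar K] =i pred0 ->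
  (0 < m)%N -> (0 < n)%N -> edge_mult K (m * n) = edge_mult K m * edge_mult K n.
Proof.
move=> char0 m0 n0.
have nz j : (0 < j)%N -> (j%:R : K) != 0.
  by rewrite ((pcharf0P K).1 char0) -lt0n.
have [two mK nK] : [/\ (2%:R : K) != 0, (m%:R : K) != 0 & (n%:R : K) != 0].
  by rewrite !nz.
have HK := hyperbolic_unary two.
have HH := hyperbolic_sqr two.
rewrite !edge_multE oddM.
(* With x, y the rounded halves of m, n, the coefficients of H in the four cases are 2xy + x + y,
   2xy + y = my, 2xy + x = xn and 2xy = xn. A unary term survives only when both weights are odd. *)
have [om|em] := boolP (odd m); have [on|en] := boolP (odd n) => /=.
- rewrite odd_halfM // natrM -gw_unaryM // mulrDl !mulrDr addrA.
  rewrite mulrnAl mulrnAr HH mulrnAl HK // mulrnAr [_ * hyperbolic K]mulrC HK //.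
  by rewrite -!mulrnA -mul2n !mulrnDr; ring.
- rewrite mulnC even_halfM // !addr0 mulrDl mulrnAl !mulrnAr HH.
  rewrite [_ * hyperbolic K]mulrC HK // -!mulrnA -mulrnDr; congr (_ *+ _).
  by rewrite -{1}(odd_double_half m) om -mul2n /=; ring.
- rewrite even_halfM // !addr0 mulrDr mulrnAl mulrnAr HH mulrnAl HK //.
  rewrite -!mulrnA -mulrnDr; congr (_ *+ _).
  by rewrite -{1}(odd_double_half n) on -mul2n /=; ring.
rewrite even_halfM // !addr0 mulrnAl mulrnAr HH -!mulrnA; congr (_ *+ _).
by rewrite -{1}(even_halfK en) -mul2n; ring.
Qed.

Lemma edge_expM m n : exp_mul (edge_exp m) (edge_exp n) = edge_exp (m * n).
Proof.
rewrite /edge_exp /exp_mul oddM.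
have [om|em] := boolP (odd m); have [on|en] := boolP (odd n) => //=.
- by rewrite !odd_predn_half ?oddM ?om // odd_halfM // muln1 mul1n.
- rewrite odd_predn_half // [(m * n)%N]mulnC even_halfM //; congr (_, _).
  by rewrite -[in RHS](odd_double_half m) om -!mul2n /=; ring.
- rewrite odd_predn_half // even_halfM //; congr (_, _).
  by rewrite -[in RHS](odd_double_half n) on -!mul2n /=; ring.
rewrite even_halfM //; congr (_, _).
by rewrite -[in RHS](even_halfK en) -!mul2n; ring.
Qed.

Lemma edge_exp_half n : (edge_exp n).1 = n./2.
Proof. by rewrite /edge_exp; case: ifP => [/odd_predn_half|]. Qed.

(** The product of the weights of all edges of a marking: subdivision doubles each edge of [D],
    hence the square. *)
Definition total_weight a lr ll (wr : 'I_lr -> nat) (wl : 'I_ll -> nat)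
    (D : seq (edge a)) : nat :=
  ((\prod_(e <- D) wt e) ^ 2 * (\prod_i wl i * \prod_j wr j))%N.

Lemma diagram_expE a lr ll (wr : 'I_lr -> nat) (wl : 'I_ll -> nat)
    (D : seq (edge a)) :
  diagram_exp wr wl D = edge_exp (total_weight wr wl D).
Proof.
(* Read backwards, this morphism property moves the products of expansions into [nat], where the
   monoid laws are at hand. *)
have mor := big_morph edge_exp (fun m n => esym (edge_expM m n)) (erefl : edge_exp 1 = exp_one).
rewrite /diagram_exp -!mor; under eq_bigr do rewrite edge_expM.
by rewrite -mor !edge_expM big_split /= mulnn.
Qed.

Lemma diagram_multE (K : fieldType) a lr ll (wr : 'I_lr -> nat)
    (wl : 'I_ll -> nat) (D : seq (edge a)) :
  [pchar K] =i pred0 -> (forall e, e \in D -> (0 < wt e)%N) ->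
  (forall i, (0 < wl i)%N) -> (forall j, (0 < wr j)%N) ->
  diagram_mult wr wl K D = edge_mult K (total_weight wr wl D).
Proof.
move=> char0 D0 wl0 wr0.
(* Positivity is carried along in the induction because [edge_multM] requires both factors to be
   positive. *)
have prodM (I : eqType) (r : seq I) (F : I -> nat) : (forall i, i \in r -> (0 < F i)%N) ->
    (0 < \prod_(i <- r) F i)%N /\
    edge_mult K (\prod_(i <- r) F i)%N = \prod_(i <- r) edge_mult K (F i).
  move=> F0; rewrite !big_seq.
  apply: (big_rec2 (fun x y => (0 < x)%N /\ edge_mult K x = y)) => [|i x y iF [y0 <-]].
    by split=> //; rewrite edge_multE /= mulr0n add0r gw_unary1.
  by rewrite muln_gt0 F0 // y0 edge_multM // F0.
have [d0 dE] := prodM _ _ _ D0.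
have [l0 lE] := prodM _ _ _ (fun i (_ : i \in index_enum _) => wl0 i).
have [r0 rE] := prodM _ _ _ (fun i (_ : i \in index_enum _) => wr0 i).
rewrite /total_weight -mulnn !edge_multM ?muln_gt0 ?d0 ?l0 ?r0 //.
by rewrite dE lE rE /diagram_mult big_split /= mulrA.
Qed.

(** * The count as a finite sum over diagrams *)

Definition diagrams a k g : seq {mset edge a}%mset := fset_set (@floor_diagrams a k g).

Lemma mem_diagrams a k g (D : {mset edge a}%mset) :
  D \in diagrams a k g -> floor_diagram k (enum_mset D).
Proof.
rewrite in_fset_set; last exact: finite_floor_diagrams.
by rewrite inE => -[].
Qed.

Lemma floor_countE k a g lr ll (wr : 'I_lr -> nat) (wl : 'I_ll -> nat) (K : fieldType) :
  floor_count k a g wr wl K =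
  \sum_(D <- diagrams a k g)
    diagram_mult wr wl K (enum_mset D) *+ num_markings wr wl (enum_mset D) k.
Proof. by rewrite /floor_count fsbig_finite //; apply: finite_floor_diagrams. Qed.

Lemma hyperbolic_coefE k a g lr ll (wr : 'I_lr -> nat) (wl : 'I_ll -> nat) :
  hyperbolic_coef k a g wr wl =
  (\sum_(D <- diagrams a k g) num_markings wr wl (enum_mset D) k *
     (total_weight wr wl (enum_mset D))./2)%N.
Proof.
rewrite /hyperbolic_coef fsbig_finite; last exact: finite_floor_diagrams.
by apply: eq_bigr => D _; rewrite diagram_expE edge_exp_half.
Qed.

(** A diagram of even total weight contributes multiples of H only. One of odd total weight adds one
    unary form per marking, and modulo squares this form is the same for all diagrams, so the copies
    can simply be counted. *)
Lemma floor_count_odd (K : fieldType) k a g lr ll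
    (wr : 'I_lr -> nat) (wl : 'I_ll -> nat) :
  [pchar K] =i pred0 -> odd_weights k a wr wl ->
  floor_count k a g wr wl K =
    hyperbolic K *+ hyperbolic_coef k a g wr wl +
    gw_unary (((\prod_j wr j) * (\prod_i wl i))%N%:R : K) *+
      (\sum_(D <- diagrams a k g)
        odd (total_weight wr wl (enum_mset D)) * num_markings wr wl (enum_mset D) k)%N.
Proof.
move=> char0 [wr_odd wl_odd _].
rewrite floor_countE hyperbolic_coefE -!sumrMnr -big_split /=.
rewrite [LHS]big_seq [RHS]big_seq; apply: eq_bigr => D DD.
have /and3P[/allP Dpos _ _] := mem_diagrams DD.
have D0 e : e \in enum_mset D -> (0 < wt e)%N by move=> /Dpos /andP[].
rewrite diagram_multE //; try by move=> i; apply: odd_gt0.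
rewrite edge_multE mulrnDl -mulrnA [(_ * _./2)%N]mulnC; congr (_ + _).
case: ifP => _; last by rewrite mul0n !mulr0n mul0rn.
(* The square of the product of the diagram's own weights is discarded; it is nonzero in [K] by
   characteristic 0. *)
rewrite mul1n /total_weight natrM [X in gw_unary X]mulrC natrX gw_unary_sqr.
  by rewrite mulnC.
by rewrite ((pcharf0P K).1 char0) -lt0n big_seq prodn_cond_gt0.
Qed.

(** * Sign cells of a hyperplane arrangement *)

Definition sign_of (R : realType) (x : R) : option bool :=
  if x == 0 then None else Some (0 < x).

Definition opp_affine (R : realType) n (l : 'cV[R]_n * R) : 'cV[R]_n * R :=
  (- l.1, - l.2).

Lemma affine_opp (R : realType) n (l : 'cV[R]_n * R) x :
  affine (opp_affine l) x = - affine l x.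
Proof. by rewrite /affine /= mulmxN mxE opprD. Qed.

(** A face of the arrangement given by its sign vector. Cells only admit inequalities [0 < _], so a
    negative sign is imposed through the opposite function; sign vectors that do not occur give
    empty cells. *)
Definition sign_cell (R : realType) n m (L : 'I_m -> 'cV[R]_n * R)
    (s : {ffun 'I_m -> option bool}) : cell R n :=
  Cell [seq L j | j <- enum 'I_m & s j == None]
       ([seq L j | j <- enum 'I_m & s j == Some true] ++
        [seq opp_affine (L j) | j <- enum 'I_m & s j == Some false]).

Lemma in_sign_cell (R : realType) n m (L : 'I_m -> 'cV[R]_n * R) s x :
  in_cell x (sign_cell L s) = (s == [ffun j => sign_of (affine (L j) x)]).
Proof.
have allE (A : pred ('cV[R]_n * R)) f (P : pred 'I_m) :
    all A [seq f j | j <- enum 'I_m & P j] = [forall j, P j ==> A (f j)].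
  rewrite all_map all_filter; apply/allP/forallP => [h j|h j _]; last exact: h.
  by apply: h; rewrite mem_enum.
rewrite /in_cell /= all_cat !allE; apply/idP/eqP => [/and3P[h0 hp hn]|->].
  apply/ffunP => j; rewrite ffunE /sign_of.
  move: (forallP h0 j) (forallP hp j) (forallP hn j); rewrite affine_opp oppr_gt0.
  by case: (s j) => [[]|] /=; case: ltgtP.
apply/and3P; split; apply/forallP => j; rewrite ffunE ?affine_opp ?oppr_gt0 /sign_of;
  by case: ltgtP.
Qed.

Definition zero_pattern_on (R : realType) n (T : Type) (pt : T -> 'rV[R]_n)
    (L : seq ('cV[R]_n * R)) (w w' : T) :=
  forall l, l \in L -> (affine l (pt w) == 0) = (affine l (pt w') == 0).

(** Points with the same vanishing pattern need not form a single polyhedral cell, but the sign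
    cells refine these classes and partition the space. It thus suffices to be polynomial on each
    vanishing class. *)
Lemma piecewise_polynomialP (R : realType) n (T : Type) (H : T -> Prop)
    (pt : T -> 'rV[R]_n) (f : T -> R) (L : seq ('cV[R]_n * R)) :
  (forall w0, H w0 -> exists p : mpoly.mpoly n R, forall w, H w ->
     zero_pattern_on pt L w w0 -> f w = mpoly.meval (pt w 0) p) ->
  piecewise_polynomial H pt f.
Proof.
move=> fP; pose L' (j : 'I_(size L)) := tnth (in_tuple L) j.
pose S : finType := {ffun 'I_(size L) -> option bool}.
exists #|S|, (fun i => sign_cell L' (enum_val i)); split=> [x|i].
  exists (enum_rank ([ffun j => sign_of (affine (L' j) x)] : S)).
  split=> [|i]; first by rewrite in_sign_cell enum_rankK.
  by rewrite in_sign_cell => /eqP <-; rewrite enum_valK.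
(* A point of [H] in the cell selects the polynomial; a cell without points of [H] receives the zero
   polynomial. *)
have [[w0 [Hw0 w0i]]|no] :=
  pselect (exists w0, H w0 /\ in_cell (pt w0) (sign_cell L' (enum_val i))).
  have [p pP] := fP _ Hw0; exists p => w Hw wi; apply: pP => // l lL.
  move: wi w0i; rewrite !in_sign_cell => /eqP-> /eqP/ffunP.
  move=> /(_ (Ordinal (etrans (index_mem l L) lL))); rewrite !ffunE /L'.
  rewrite !(tnth_nth l) /= nth_index // /sign_of.
  by do 2![case: ifP].
by exists (mpoly.mpolyC n 0) => w Hw wi; case: no; exists w.
Qed.

(** * Affine functions of a point and polynomials in its coordinates *)

Definition affine_fun (R : realType) n (T : Type) (pt : T -> 'rV[R]_n) (f : T -> R) :=
  exists l, forall w, f w = affine l (pt w).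

Section AffineFunctions.
Variables (R : realType) (n : nat) (T : Type) (pt : T -> 'rV[R]_n).
Implicit Types f g : T -> R.

Lemma affine_fun_cst c : affine_fun pt (fun=> c).
Proof. by exists (0, c) => w; rewrite /affine mulmx0 mxE add0r. Qed.

Lemma affine_fun_coord i : affine_fun pt (fun w => pt w 0 i).
Proof.
by exists (delta_mx i 0, 0) => w; rewrite /affine /= addr0 -colE mxE.
Qed.

Lemma affine_funD f g :
  affine_fun pt f -> affine_fun pt g -> affine_fun pt (fun w => f w + g w).
Proof.
move=> [l lE] [l' l'E]; exists (l.1 + l'.1, l.2 + l'.2) => w.
by rewrite lE l'E /affine mulmxDr [X in _ = X + _]mxE addrACA.
Qed.

Lemma affine_funN f : affine_fun pt f -> affine_fun pt (fun w => - f w).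
Proof. by move=> [l lE]; exists (opp_affine l) => w; rewrite affine_opp lE. Qed.

Lemma affine_funB f g :
  affine_fun pt f -> affine_fun pt g -> affine_fun pt (fun w => f w - g w).
Proof. by move=> fA /affine_funN; apply: affine_funD. Qed.

Lemma affine_fun_sum (I : Type) (r : seq I) (F : I -> T -> R) :
  (forall i, affine_fun pt (F i)) -> affine_fun pt (fun w => \sum_(i <- r) F i w).
Proof.
move=> FA; elim: r => [|i r [l lE]].
  by have [l lE] := affine_fun_cst 0; exists l => w; rewrite big_nil; apply: lE.
have [l' l'E] := affine_funD (FA i) (ex_intro _ l lE).
by exists l' => w; rewrite big_cons; apply: l'E.
Qed.

Lemma affine_fun_zeros (I : finType) (F : I -> T -> R) :
  (forall i, affine_fun pt (F i)) ->
  exists L, forall w w', zero_pattern_on pt L w w' ->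
    forall i, (F i w == 0) = (F i w' == 0).
Proof.
move=> /fin_all_exists[l lE]; exists [seq l i | i : I] => w w' ww' i.
by rewrite !lE; apply/ww'/map_f; rewrite mem_enum.
Qed.

End AffineFunctions.

Section PolynomialSum.
Import mpoly.

(** The shape of the coefficient of H once the marking numbers are frozen: each diagram gives a
    multiple of the product of all end weights plus a constant. *)
Lemma mpoly_sum_prod (R : realType) n (J : Type) (r : seq J) (c d : J -> R) :
  exists p : mpoly n R, forall v : 'I_n -> R,
    meval v p = \sum_(x <- r) (c x * \prod_i v i + d x).
Proof.
exists (\sum_(x <- r) (c x *: \prod_i mpolyX R (mnm1 i) + mpolyC n (d x))) => v.
rewrite rmorph_sum /=; apply: eq_bigr => x _.
rewrite mevalD mevalZ mevalC rmorph_prod /=; congr (_ * _ + _).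
by apply: eq_bigr => i _; rewrite mevalXU.
Qed.

End PolynomialSum.

Lemma zero_pattern_catl (R : realType) n (T : Type) (pt : T -> 'rV[R]_n) L L' w w' :
  zero_pattern_on pt (L ++ L') w w' -> zero_pattern_on pt L w w'.
Proof. by move=> ww' l lL; apply: ww'; rewrite mem_cat lL. Qed.

Lemma zero_pattern_catr (R : realType) n (T : Type) (pt : T -> 'rV[R]_n) L L' w w' :
  zero_pattern_on pt (L ++ L') w w' -> zero_pattern_on pt L' w w'.
Proof. by move=> ww' l lL; apply: ww'; rewrite mem_cat lL orbT. Qed.

(** * Dependence of the marking numbers on the end weights *)

Section WeightSpace.
Variables (R : realType) (lr ll : nat).
Implicit Types w : ('I_lr -> nat) * ('I_ll -> nat).

Definition weight_vector w : 'rV[R]_(lr + ll) :=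
  row_mx (\row_j (w.1 j)%:R) (\row_i (w.2 i)%:R).

Lemma prod_weight_vector w :
  \prod_i weight_vector w 0 i = (\prod_i w.2 i * \prod_j w.1 j)%N%:R.
Proof.
rewrite big_split_ord mulnC natrM !natr_prod /=.
by congr (_ * _); apply: eq_bigr => i _; rewrite ?row_mxEl ?row_mxEr mxE.
Qed.

Lemma affine_fun_wr j : affine_fun weight_vector (fun w => (w.1 j)%:R).
Proof.
have [l lE] := affine_fun_coord weight_vector (lshift ll j).
by exists l => w; rewrite -lE row_mxEl mxE.
Qed.

Lemma affine_fun_wl i : affine_fun weight_vector (fun w => (w.2 i)%:R).
Proof.
have [l lE] := affine_fun_coord weight_vector (rshift lr i).
by exists l => w; rewrite -lE row_mxEr mxE.
Qed.

(** For a fixed premarking the branch taken in [mweight] does not depend on the end weights, so the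
    value is a constant or a single coordinate. *)
Lemma affine_fun_mweight a (D : seq (edge a)) (M : premarking lr ll D) u v :
  affine_fun weight_vector (fun w => (mweight w.1 w.2 M u v)%:R).
Proof.
have cst := affine_fun_cst weight_vector.
by case: u v => [u|[u|[u|u]]] [v|[v|[v|v]]] /=; try exact: cst; case: (_ == _);
  do ?[exact: cst|exact: affine_fun_wl|exact: affine_fun_wr].
Qed.

Lemma affine_fun_mdiv a (D : seq (edge a)) (M : premarking lr ll D) v :
  affine_fun weight_vector (fun w => (mdiv w.1 w.2 M v)%:~R).
Proof.
(* [F] selects the edges into [v] or those out of [v], so one statement covers both sums of the
   divergence. *)
have sumA (F : mvertex lr ll D -> mvertex lr ll D * mvertex lr ll D) :
    affine_fun weight_vector
      (fun w => \sum_u ((mweight w.1 w.2 M (F u).1 (F u).2)%:R : R)).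
  by apply: affine_fun_sum => u; apply: affine_fun_mweight.
have [l lE] := affine_funB (sumA (fun u => (u, v))) (sumA (fun u => (v, u))).
by exists l => w; rewrite -lE /mdiv rmorphB /= !rmorph_sum.
Qed.

(** The type of premarkings does not involve the end weights, so all conditions range over one fixed
    finite family. *)
Lemma num_markings_const k a (D : seq (edge a)) :
  exists L, forall w w', zero_pattern_on weight_vector L w w' ->
    num_markings w.1 w.2 D k = num_markings w'.1 w'.2 D k.
Proof.
(* [L1] tests whether a divergence equals [k], [L2] whether an edge is present, and [L3] whether two
   weights, possibly of different premarkings, agree. *)
have [L1 L1P] := affine_fun_zeros (I := (premarking lr ll D * mvertex lr ll D)%type)
  (fun i => affine_funB (affine_fun_mdiv i.1 i.2) (affine_fun_cst weight_vector k%:R)).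
pose J := (premarking lr ll D * mvertex lr ll D * mvertex lr ll D)%type.
have [L2 L2P] := affine_fun_zeros (I := J)
  (fun i => affine_fun_mweight i.1.1 i.1.2 i.2).
have [L3 L3P] := affine_fun_zeros (I := (J * J)%type)
  (fun i => affine_funB (affine_fun_mweight i.1.1.1 i.1.1.2 i.1.2)
                        (affine_fun_mweight i.2.1.1 i.2.1.2 i.2.2)).
exists (L1 ++ (L2 ++ L3)) => w w' ww'.
have {}L1P := L1P _ _ (zero_pattern_catl ww').
have {}L2P := L2P _ _ (zero_pattern_catl (zero_pattern_catr ww')).
have {}L3P := L3P _ _ (zero_pattern_catr (zero_pattern_catr ww')).
have divE (M : premarking lr ll D) v :
    (mdiv w.1 w.2 M v == k%:Z) = (mdiv w'.1 w'.2 M v == k%:Z).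
  by have := L1P (M, v); rewrite /= !subr_eq0 !pmulrn !eqr_int.
(* Weights are natural numbers, so positivity is nonvanishing and is seen by the zero pattern. *)
have posE (M : premarking lr ll D) u v :
    (0 < mweight w.1 w.2 M u v)%N = (0 < mweight w'.1 w'.2 M u v)%N.
  by have := L2P (M, u, v); rewrite /= !pnatr_eq0 !lt0n => ->.
have eqE (M M' : premarking lr ll D) u v u' v' :
    (mweight w.1 w.2 M u v == mweight w.1 w.2 M' u' v') =
    (mweight w'.1 w'.2 M u v == mweight w'.1 w'.2 M' u' v').
  by have := L3P ((M, u, v), (M', u', v')); rewrite /= !subr_eq0 !eqr_nat.
rewrite /num_markings.
have -> : @marking_equiv a lr ll w.1 w.2 D = @marking_equiv a lr ll w'.1 w'.2 D.
  apply/funext => M; apply/funext => M'; apply: eq_existsb => f.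
  by congr [&& _, _ & _]; apply: eq_forallb => u; apply: eq_forallb => v; rewrite eqE.
congr #|equivalence_partition _ _|; apply/setP => M; rewrite !inE.
congr [&& _, _, _ & _]; first by apply: eq_forallb => v; rewrite divE.
by apply: eq_forallb => u; apply: eq_forallb => v; rewrite posE.
Qed.

Lemma num_markings_const_seq k a (r : seq {mset edge a}%mset) :
  exists L, forall w w', zero_pattern_on weight_vector L w w' ->
    forall D, D \in r ->
    num_markings w.1 w.2 (enum_mset D) k = num_markings w'.1 w'.2 (enum_mset D) k.
Proof.
elim: r => [|D r [L LP]]; first by exists [::].
have [L' L'P] := num_markings_const k (enum_mset D).
exists (L' ++ L) => w w' ww' D'; rewrite inE => /predU1P[->|D'r].
  exact/L'P/(zero_pattern_catl ww').
exact: (LP _ _ (zero_pattern_catr ww')).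
Qed.

(** * The coefficient of H as a polynomial in the end weights *)

(** Rounding down amounts to subtracting the parity, so [n./2] is polynomial in [n] wherever the
    parity is constant. *)
Lemma half_natr n : (n./2)%:R = (n%:R - (odd n)%:R) / 2%:R :> R.
Proof.
rewrite -{2}(odd_double_half n) natrD addrC addKr -muln2 natrM mulfK //.
by rewrite pnatr_eq0.
Qed.

(** The end weights are odd and squaring preserves parity, so the parity term of [half_natr] depends
    on the diagram only. *)
Lemma odd_total_weight k a w (D : seq (edge a)) : odd_weights k a w.1 w.2 ->
  odd (total_weight w.1 w.2 D) = odd (\prod_(e <- D) wt e)%N.
Proof.
move=> [wr_odd wl_odd _].
have odd_prod (I : finType) (F : I -> nat) : (forall i, odd (F i)) -> odd (\prod_i F i)%N.
  by move=> Fo; apply: (big_ind (fun x => odd x)) => // x y; rewrite oddM => -> ->.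
by rewrite /total_weight -mulnn !oddM !odd_prod // andbb !andbT.
Qed.

End WeightSpace.

Lemma piecewise_polynomial_hyperbolic_coef (R : realType) k a g lr ll :
  piecewise_polynomial
    (fun w : ('I_lr -> nat) * ('I_ll -> nat) => odd_weights k a w.1 w.2)
    (weight_vector R (lr := lr) (ll := ll))
    (fun w => (hyperbolic_coef k a g w.1 w.2)%:R).
Proof.
have [L LP] := num_markings_const_seq R lr ll k (diagrams a k g).
apply: (@piecewise_polynomialP R _ _ _ _ _ L) => w0 Hw0.
pose nu (D : {mset edge a}%mset) : R := (num_markings w0.1 w0.2 (enum_mset D) k)%:R.
pose W (D : {mset edge a}%mset) := (\prod_(e <- enum_mset D) wt e)%N.
(* With P the product of the end weights, the summand is [nu D] times (W^2 P - odd W) / 2, where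
   [nu] is frozen at [w0]. *)
have [p pE] := mpoly_sum_prod (lr + ll) (diagrams a k g)
  (fun D => nu D * ((W D)%:R ^+ 2 / 2%:R)) (fun D => - nu D * ((odd (W D))%:R / 2%:R)).
exists p => w Hw ww0; rewrite pE hyperbolic_coefE natr_sum.
rewrite [LHS]big_seq [RHS]big_seq; apply: eq_bigr => D DD.
rewrite natrM (LP _ _ ww0 _ DD) half_natr (odd_total_weight _ Hw).
rewrite /total_weight -/(nu D) -/(W D); move: (nu D) (W D) => x y.
by rewrite natrM natrX prod_weight_vector; ring.
Qed.

Theorem theoremD (K : fieldType) (R : realType) (k a g lr ll : nat)
    (char0 : [pchar K] =i pred0) (a_gt0 : (0 < a)%N) (lr_gt0 : (0 < lr)%N)
    (ll_gt0 : (0 < ll)%N) :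
  (forall (wr : 'I_lr -> nat) (wl : 'I_ll -> nat), odd_weights k a wr wl ->
    exists s : seq int,
      floor_count k a g wr wl K =
        hyperbolic K *+ hyperbolic_coef k a g wr wl +
        \sum_(i <- s) gw_unary ((-1 : K) ^ i * ((\prod_j wr j) * (\prod_i wl i))%N%:R)) /\
  piecewise_polynomial (R := R)
    (fun w : ('I_lr -> nat) * ('I_ll -> nat) => odd_weights k a w.1 w.2)
    (fun w => row_mx (\row_j (w.1 j)%:R) (\row_i (w.2 i)%:R))
    (fun w => (hyperbolic_coef k a g w.1 w.2)%:R).
Proof.
split=> [wr wl Hw|]; last exact: piecewise_polynomial_hyperbolic_coef.
rewrite (floor_count_odd g char0 Hw); set n := (\sum_(D <- _) _)%N.
(* All signs can be taken to be (-1)^0: the [n] unary forms are equal. *)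
exists (nseq n 0); congr (_ + _).
by rewrite big_nseq iter_addr addr0 expr0z mul1r.
Qed.
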